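(* A quadratic form $\phi$ in the 21 elastic moduli is invariant under $SO(3)$ if and only if it is of the form $\phi=c^tFc$, where $F$ is a $21\times 21$ symmetric matrix of block form $$F=\begin{pmatrix} A_{9\times 9} & 0_{9\times 12}\\ 0_{12\times 9} & B_{12\times 12}\end{pmatrix},$$ with $A$ and $B$ symmetric matrices, defined by 12 and 7 elements respectively, of the form (only the upper triangles are displayed; the lower triangles are determined by symmetry) $$A=\left(\begin{array}{ccccccccc} f_{11}&f_{12}&f_{12}&f_{14}&f_{15}&f_{15}&f_{17}&f_{18}&f_{18}\\ &f_{11}&f_{12}&f_{15}&f_{14}&f_{15}&f_{18}&f_{17}&f_{18}\\ &&f_{11}&f_{15}&f_{15}&f_{14}&f_{18}&f_{18}&f_{17}\\ &&&f_{44}&f_{45}&f_{45}&f_{47}&f_{48}&f_{48}\\ &&&&f_{44}&f_{45}&f_{48}&f_{47}&f_{48}\\ &&&&&f_{44}&f_{48}&f_{48}&f_{47}\\ &&&&&&f_{77}&f_{78}&f_{78}\\ &&&&&&&f_{77}&f_{78}\\ &&&&&&&&f_{77} \end{array}\right),$$ $$B=\left(\begin{array}{cccccccccccc} b_{11}&0&0&b_{14}&0&0&b_{14}&0&0&b_{1,10}&0&0\\ &b_{11}&0&0&b_{14}&0&0&b_{14}&0&0&b_{1,10}&0\\ &&b_{11}&0&0&b_{14}&0&0&b_{14}&0&0&b_{1,10}\\ &&&b_{44}&0&0&b_{47}&0&0&b_{4,10}&0&0\\ &&&&b_{44}&0&0&b_{47}&0&0&b_{4,10}&0\\ &&&&&b_{44}&0&0&b_{47}&0&0&b_{4,10}\\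 &&&&&&b_{44}&0&0&b_{4,10}&0&0\\ &&&&&&&b_{44}&0&0&b_{4,10}&0\\ &&&&&&&&b_{44}&0&0&b_{4,10}\\ &&&&&&&&&b_{10,10}&0&0\\ &&&&&&&&&&b_{10,10}&0\\ &&&&&&&&&&&b_{10,10} \end{array}\right),$$ where the 19 elements $f_{11},f_{12},f_{14},f_{15},f_{17},f_{18},f_{44},f_{45},f_{47},f_{48},f_{77},f_{78},b_{11},b_{14},b_{1,10},b_{44},b_{47},b_{4,10},b_{10,10}$ are arbitrary real numbers subject to the following 12 linearly independent conditions: $$\begin{aligned} 2f_{11}+2f_{12}-4f_{15}+f_{44}-f_{77}&=0,\\ 2f_{11}+2f_{12}-2f_{18}-f_{44}-f_{47}&=0,\\ 2f_{12}-f_{14}-f_{17}&=0,\\ f_{14}+f_{15}-f_{45}-f_{48}&=0,\\ f_{17}+f_{18}-f_{48}-f_{78}&=0,\\ 2f_{44}-2f_{45}-b_{11}&=0,\\ 2f_{14}-2f_{15}+b_{14}&=0,\\ 2f_{47}-2f_{48}-b_{1,10}&=0,\\ 4f_{11}-2f_{15}-2f_{18}-b_{44}&=0,\\ 4f_{12}-2f_{15}-2f_{18}+b_{47}&=0,\\ 2f_{17}-2f_{18}+b_{4,10}&=0,\\ 2f_{77}-2f_{78}-b_{10,10}&=0. \end{aligned}$$ The number of linearly independent quadratic invariants under $SO(3)$ is seven; that is, the real vector space of $SO(3)$-invariant quadratic forms in the moduli has dimension 7.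
   Context: Let $\mathbb{E}$ be the 21-dimensional real vector space of fourth-order tensors $(c_{ijkl})$, $i,j,k,l\in\{1,2,3\}$, with the symmetries $c_{ijkl}=c_{jikl}$ and $c_{ijkl}=c_{klij}$ (no positive-definiteness is imposed). An orthogonal matrix $Q\in O(3)$ acts on $\mathbb{E}$ by $c_{ijkl}\mapsto Q_{ip}Q_{jq}Q_{kr}Q_{ls}c_{pqrs}$ (summation over repeated indices). A quadratic invariant under a group $G\subseteq O(3)$ is a real quadratic form $\phi$ on $\mathbb{E}$ with $\phi(Q\cdot C)=\phi(C)$ for all $Q\in G$, $C\in\mathbb{E}$. Voigt notation: $c_{IJ}=c_{ijkl}$ with $I=1,2,3,4,5,6$ corresponding to $ij=11,22,33,23,31,12$ (and likewise $J$ to $kl$), so $c_{IJ}=c_{JI}$. The 21-vector of elastic moduli (in this order) is $$c=(c_{11},c_{22},c_{33},c_{23},c_{13},c_{12},c_{44},c_{55},c_{66},c_{14},c_{25},c_{36},c_{34},c_{15},c_{26},c_{24},c_{35},c_{16},c_{56},c_{46},c_{45})^t .$$ The rows and columns of $A$ correspond to the first 9 components of $c$, and those of $B$ to the last 12 components. *)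

(* Defs.v *)
From HB Require Import structures.
From mathcomp Require Import all_boot all_order all_algebra.
From mathcomp Require Import boolp classical_sets functions reals.

Set Implicit Arguments.
Unset Strict Implicit.
Unset Printing Implicit Defensive.

Import GRing.Theory.

Local Open Scope ring_scope.
Local Open Scope classical_set_scope.

(* Tensor indices 1, 2, 3 are the elements 0, 1, 2 of 'I_3. *)
Definition elastic_sym (R : realType) :
    {pred {ffun 'I_3 * 'I_3 * 'I_3 * 'I_3 -> R^o}} :=
  fun c => [forall i, forall j, forall k, forall l,
    (c (i, j, k, l) == c (j, i, k, l)) && (c (i, j, k, l) == c (k, l, i, j))].

Lemma elastic_symP (R : realType)
    (c : {ffun 'I_3 * 'I_3 * 'I_3 * 'I_3 -> R^o}) :
  reflect (forall i j k l, c (i, j, k, l) = c (j, i, k, l) /\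
                           c (i, j, k, l) = c (k, l, i, j))
          (c \in @elastic_sym R).
Proof.
apply: (iffP idP) => [H i j k l | H].
  move/forallP/(_ i)/forallP/(_ j)/forallP/(_ k)/forallP/(_ l)/andP: H.
  by case=> /eqP -> /eqP ->.
apply/forallP => i; apply/forallP => j; apply/forallP => k; apply/forallP => l.
by case: (H i j k l) => <- <-; rewrite !eqxx.
Qed.

Lemma elastic_sym_submod (R : realType) : submod_closed (@elastic_sym R).
Proof.
split=> [|a u v /elastic_symP Hu /elastic_symP Hv]; apply/elastic_symP => i j k l.
  by rewrite !ffunE.
rewrite !ffunE; case: (Hu i j k l) => <- <-; by case: (Hv i j k l) => <- <-.
Qed.

HB.instance Definition _ (R : realType) :=
  GRing.isSubmodClosed.Build R _ (@elastic_sym R) (@elastic_sym_submod R).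

Record elast (R : realType) := Elast {
  tensor_of :> {ffun 'I_3 * 'I_3 * 'I_3 * 'I_3 -> R^o};
  elastP : tensor_of \in @elastic_sym R }.

HB.instance Definition _ (R : realType) := [isSub for @tensor_of R].
HB.instance Definition _ (R : realType) := [Choice of elast R by <:].
HB.instance Definition _ (R : realType) :=
  [SubChoice_isSubLmodule of elast R by <:].

Definition rot_tensor (R : realType) (Q : 'M[R]_3) (C : elast R) :
    {ffun 'I_3 * 'I_3 * 'I_3 * 'I_3 -> R^o} :=
  [ffun x : 'I_3 * 'I_3 * 'I_3 * 'I_3 => let: (i, j, k, l) := x in
    \sum_p \sum_q \sum_r \sum_s
      Q i p * Q j q * Q k r * Q l s * C (p, q, r, s)].

Lemma rot_tensor_sym (R : realType) (Q : 'M[R]_3) (C : elast R) :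
  rot_tensor Q C \in @elastic_sym R.
Proof.
have /elastic_symP H := elastP C.
apply/elastic_symP => i j k l; rewrite !ffunE; split.
  rewrite exchange_big /=; apply: eq_bigr => p _; apply: eq_bigr => q _.
  apply: eq_bigr => r _; apply: eq_bigr => s _.
  by rewrite (H q p r s).1 [Q i q * _]mulrC.
rewrite pair_big [RHS]pair_big /=.
under eq_bigr do rewrite pair_big.
under [RHS]eq_bigr do rewrite pair_big.
rewrite exchange_big /=; apply: eq_bigr => -[r s] _; apply: eq_bigr => -[p q] _.
rewrite (H p q r s).2 /=; congr (_ * _); by rewrite -mulrA mulrC !mulrA.
Qed.

Definition act (R : realType) (Q : 'M[R]_3) (C : elast R) : elast R :=
  Elast (rot_tensor_sym Q C).

Definition SO3 (R : realType) : set 'M[R]_3 :=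
  [set Q | Q *m Q^T = 1%:M /\ \det Q = 1].

Definition quadratic_form (R : realType) (phi : elast R -> R^o) : Prop :=
  exists b : {biscalar (elast R)}, forall C, phi C = b C C.

Definition invariant_under (R : realType) (G : set 'M[R]_3)
    (phi : elast R -> R^o) : Prop :=
  forall Q, G Q -> forall C, phi (act Q C) = phi C.

Definition quadratic_invariants (R : realType) (G : set 'M[R]_3) :
    set (elast R -> R^o) :=
  [set phi | quadratic_form phi /\ invariant_under G phi].

Definition lin_indep (R : realType) (U : lmodType R) (n : nat)
    (e : 'I_n -> U) : Prop :=
  forall a : 'I_n -> R, \sum_i a i *: e i = 0 -> forall i, a i = 0.

(* V is a linear subspace of dimension n: it is the span of n linearly
   independent vectors.  The ambient U may be infinite-dimensional. *)
Definition has_dim (R : realType) (U : lmodType R) (V : set U) (n : nat) : Prop :=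
  exists2 e : 'I_n -> U, lin_indep e &
    V = [set \sum_i a i *: e i | a in [set: 'I_n -> R]].

(* Voigt labels are 1-based; the last branch is label 6. *)
Definition voigt_pair (K : nat) : 'I_3 * 'I_3 :=
  match K with
  | 1 => (0, 0) | 2 => (1, 1) | 3 => (2, 2)
  | 4 => (1, 2) | 5 => (2, 0) | _ => (0, 1)
  end.

Definition voigt (R : realType) (C : elast R) (K L : nat) : R :=
  let: (i, j) := voigt_pair K in let: (k, l) := voigt_pair L in C (i, j, k, l).

Definition moduli_labels : seq (nat * nat) :=
  [:: (1, 1); (2, 2); (3, 3); (2, 3); (1, 3); (1, 2); (4, 4); (5, 5); (6, 6);
      (1, 4); (2, 5); (3, 6); (3, 4); (1, 5); (2, 6);
      (2, 4); (3, 5); (1, 6); (5, 6); (4, 6); (4, 5)]%N.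

Definition moduli (R : realType) (C : elast R) : 'cV[R]_(9 + 12) :=
  \col_n (let: (K, L) := nth (0, 0)%N moduli_labels n in voigt C K L).

(* The symmetric matrix whose upper triangle is listed row by row, each row
   starting on the diagonal. *)
Definition symmx (R : realType) (n : nat) (rows : seq (seq R)) : 'M[R]_n :=
  \matrix_(i, j) nth 0 (nth [::] rows (minn i j)) (maxn i j - minn i j).

Record coeffs (R : realType) := Coeffs {
  f11 : R; f12 : R; f14 : R; f15 : R; f17 : R; f18 : R;
  f44 : R; f45 : R; f47 : R; f48 : R; f77 : R; f78 : R;
  b11 : R; b14 : R; b1_10 : R; b44 : R; b47 : R; b4_10 : R; b10_10 : R }.

Definition A_mx (R : realType) (x : coeffs R) : 'M[R]_9 :=
  let: Coeffs f11 f12 f14 f15 f17 f18 f44 f45 f47 f48 f77 f78 _ _ _ _ _ _ _ := x in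
  symmx 9
    [:: [:: f11; f12; f12; f14; f15; f15; f17; f18; f18];
             [:: f11; f12; f15; f14; f15; f18; f17; f18];
                  [:: f11; f15; f15; f14; f18; f18; f17];
                       [:: f44; f45; f45; f47; f48; f48];
                            [:: f44; f45; f48; f47; f48];
                                 [:: f44; f48; f48; f47];
                                      [:: f77; f78; f78];
                                           [:: f77; f78];
                                                [:: f77]].

Definition B_mx (R : realType) (x : coeffs R) : 'M[R]_12 :=
  let: Coeffs _ _ _ _ _ _ _ _ _ _ _ _ b11 b14 b1_10 b44 b47 b4_10 b10_10 := x in
  symmx 12
    [:: [:: b11; 0; 0; b14; 0; 0; b14; 0; 0; b1_10; 0; 0];
        [:: b11; 0; 0; b14; 0; 0; b14; 0; 0; b1_10; 0];
        [:: b11; 0; 0; b14; 0; 0; b14; 0; 0; b1_10];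
        [:: b44; 0; 0; b47; 0; 0; b4_10; 0; 0];
        [:: b44; 0; 0; b47; 0; 0; b4_10; 0];
        [:: b44; 0; 0; b47; 0; 0; b4_10];
        [:: b44; 0; 0; b4_10; 0; 0];
        [:: b44; 0; 0; b4_10; 0];
        [:: b44; 0; 0; b4_10];
        [:: b10_10; 0; 0];
        [:: b10_10; 0];
        [:: b10_10]].

Definition F_mx (R : realType) (x : coeffs R) : 'M[R]_(9 + 12) :=
  block_mx (A_mx x) 0 0 (B_mx x).

(* Left-hand sides: the conditions say that all twelve entries vanish. *)
Definition conditions (R : realType) (x : coeffs R) : 12.-tuple R :=
  let: Coeffs f11 f12 f14 f15 f17 f18 f44 f45 f47 f48 f77 f78
              b11 b14 b1_10 b44 b47 b4_10 b10_10 := x in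
  [tuple 2 * f11 + 2 * f12 - 4 * f15 + f44 - f77;
         2 * f11 + 2 * f12 - 2 * f18 - f44 - f47;
         2 * f12 - f14 - f17;
         f14 + f15 - f45 - f48;
         f17 + f18 - f48 - f78;
         2 * f44 - 2 * f45 - b11;
         2 * f14 - 2 * f15 + b14;
         2 * f47 - 2 * f48 - b1_10;
         4 * f11 - 2 * f15 - 2 * f18 - b44;
         4 * f12 - 2 * f15 - 2 * f18 + b47;
         2 * f17 - 2 * f18 + b4_10;
         2 * f77 - 2 * f78 - b10_10].

(* Main.v *)
(* Write phi(C) = G(C, C) with G symmetric bilinear and SO(3)-invariant.  Because
   -1 acts trivially on tensors of even order, G is invariant under all signed
   permutation matrices: sign changes kill every entry of the Gram matrix in
   which some index occurs an odd number of times, and permutations of the axes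
   identify the remaining ones, which leaves the 19 coefficients of F.  The half
   turn about the bisector of e_1 and e_1 + e_2 then gives the 12 linear
   conditions.  Conversely, the solutions of the conditions are the combinations
   of the seven invariants (tr a)^2, (tr a)(tr b), (tr b)^2, a:a, a:b, b:b and
   C::C, where a_ij = c_ijkk and b_ij = c_ikjk. *)
Require Import Defs.
From HB Require Import structures.
From mathcomp Require Import all_boot all_order all_algebra.
From mathcomp Require Import fingroup perm.
From mathcomp Require Import ring lra.
From mathcomp Require Import boolp classical_sets functions reals.

Set Implicit Arguments.
Unset Strict Implicit.
Unset Printing Implicit Defensive.

Import Order.TTheory GRing.Theory Num.Theory.

Local Open Scope ring_scope.

(** * Sums and case analysis over the three tensor indices *)

Lemma sum3 (V : nmodType) (f : 'I_3 -> V) : \sum_i f i = f 0 + f 1 + f 2.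
Proof.
rewrite !big_ord_recl big_ord0 addr0 addrA.
by congr (f _ + f _ + f _); apply/val_inj.
Qed.

Lemma ord3P (P : 'I_3 -> Prop) : P 0 -> P 1 -> P 2 -> forall i, P i.
Proof.
move=> P0 P1 P2 [[|[|[|//]]] lti].
- by rewrite (_ : Ordinal lti = 0) //; apply/val_inj.
- by rewrite (_ : Ordinal lti = 1) //; apply/val_inj.
- by rewrite (_ : Ordinal lti = 2) //; apply/val_inj.
Qed.

(** * Index symmetries and the 21 moduli as coordinates *)

Lemma elast_symE (R : realType) (C : elast R) i j k l :
  [/\ C (j, i, k, l) = C (i, j, k, l), C (i, j, l, k) = C (i, j, k, l)
    & C (k, l, i, j) = C (i, j, k, l)].
Proof.
have /elastic_symP symC := elastP C.
split; first by rewrite (symC i j k l).1.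
  by rewrite (symC i j l k).2 (symC l k i j).1 (symC k l i j).2.
by rewrite (symC i j k l).2.
Qed.

Definition modulus (R : realType) (C : elast R) (n : nat) : R :=
  let: (K, L) := nth (0, 0)%N moduli_labels n in voigt C K L.

Lemma moduliE (R : realType) (C : elast R) :
  moduli C = \col_(n < 9 + 12) modulus C n.
Proof. by []. Qed.

Lemma elast_sort_pair (R : realType) (C D : elast R) i j k l :
  C (i, j, k, l) = D (i, j, k, l) ->
  [/\ C (j, i, k, l) = D (j, i, k, l), C (i, j, l, k) = D (i, j, l, k)
    & C (k, l, i, j) = D (k, l, i, j)].
Proof.
have [c1 c2 c3] := elast_symE C i j k l; have [d1 d2 d3] := elast_symE D i j k l.
by move=> eqCD; split; rewrite ?c1 ?c2 ?c3 eqCD ?d1 ?d2 ?d3.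
Qed.

(** The index symmetries carry every component to one whose index pairs are Voigt pairs with weakly
    increasing labels, and those 21 components are exactly the moduli. *)
Lemma moduli_inj (R : realType) : injective (@moduli R).
Proof.
move=> C D /matrixP eqCD.
have eqn n (ltn : (n < 9 + 12)%N) : modulus C n = modulus D n.
  by have := eqCD (Ordinal ltn) 0; rewrite !mxE.
suff eqv K L : (0 < K < 7)%N -> (0 < L < 7)%N -> voigt C K L = voigt D K L.
  have pairP (i j : 'I_3) : exists2 K, (0 < K < 7)%N &
      (i, j) = voigt_pair K \/ (j, i) = voigt_pair K.
    by move: i j; do 2 ![apply: ord3P];
      [exists 1%N | exists 6%N | exists 5%N | exists 6%N | exists 2%N
      | exists 4%N | exists 5%N | exists 4%N | exists 3%N]; auto.
  apply/val_inj/ffunP=> -[[[i j] k] l] /=.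
  have [K /eqv{}eqv eK] := pairP i j; have [L /eqv{eqv} eqv eL] := pairP k l.
  move: eqv; rewrite /voigt; case: eK => <-; case: eL => <- // eqv.
  - by have [] := elast_sort_pair eqv.
  - by have [] := elast_sort_pair eqv.
  by have [eqv' _ _] := elast_sort_pair eqv; have [] := elast_sort_pair eqv'.
(* The major symmetry allows sorted labels, and [moduli_labels] lists only sorted pairs. *)
wlog: K L / (K <= L)%N => [IH ltK ltL|].
  have [/IH->//|/ltnW/IH eqLK] := leqP K L.
  move: (eqLK ltL ltK); rewrite /voigt.
  by case: voigt_pair => i j; case: voigt_pair => k l /elast_sort_pair[].
have := (eqn 0, eqn 1, eqn 2, eqn 3, eqn 4, eqn 5, eqn 6)%N.
have := (eqn 7, eqn 8, eqn 9, eqn 10, eqn 11, eqn 12, eqn 13)%N.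
have := (eqn 14, eqn 15, eqn 16, eqn 17, eqn 18, eqn 19, eqn 20)%N.
rewrite /modulus /= => e1 e2 e3.
by do 7?[case: K => [|K] //]; do 7?[case: L => [|L] //] => _ _ _;
  rewrite ?e1 ?e2 ?e3.
Qed.

(** * The block form of F as an explicit bilinear polynomial *)

(* p^T M q restricted to a 3 x 3 block with diagonal entries a and off-diagonal
   entries b. *)
Definition blk3 (R : pzRingType) (a b : R) (p q : nat -> R) (m n : nat) : R :=
  (a - b) * (p m * q n + p m.+1 * q n.+1 + p m.+2 * q n.+2)
  + b * ((p m + p m.+1 + p m.+2) * (q n + q n.+1 + q n.+2)).

Definition symblk3 (R : pzRingType) (a b : R) (p q : nat -> R) (m n : nat) : R :=
  blk3 a b p q m n + blk3 a b q p m n.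

Definition F_form (R : realType) (x : coeffs R) (p q : nat -> R) : R :=
  blk3 (f11 x) (f12 x) p q 0 0 + blk3 (f44 x) (f45 x) p q 3 3
  + blk3 (f77 x) (f78 x) p q 6 6 + symblk3 (f14 x) (f15 x) p q 0 3
  + symblk3 (f17 x) (f18 x) p q 0 6 + symblk3 (f47 x) (f48 x) p q 3 6
  + blk3 (b11 x) 0 p q 9 9 + blk3 (b44 x) 0 p q 12 12
  + blk3 (b44 x) 0 p q 15 15 + blk3 (b10_10 x) 0 p q 18 18
  + symblk3 (b14 x) 0 p q 9 12 + symblk3 (b14 x) 0 p q 9 15
  + symblk3 (b1_10 x) 0 p q 9 18 + symblk3 (b47 x) 0 p q 12 15
  + symblk3 (b4_10 x) 0 p q 12 18 + symblk3 (b4_10 x) 0 p q 15 18.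

(** Sums over numeric ranges unfold to explicit terms once [n] is a numeral, which leaves identities
    that [ring] can decide. *)
Lemma symmx_formE (R : realType) (n : nat) (rows : seq (seq R)) (p q : nat -> R) :
  ((\col_(i < n) p i)^T *m symmx n rows *m (\col_(i < n) q i)) 0 0 =
    \sum_(0 <= j < n) (\sum_(0 <= i < n)
      p i * nth 0 (nth [::] rows (minn i j)) (maxn i j - minn i j)) * q j.
Proof.
rewrite mxE big_mkord; apply: eq_bigr => j _; rewrite !mxE big_mkord.
by congr (_ * _); apply: eq_bigr => i _; rewrite !mxE.
Qed.

Lemma F_mxE (R : realType) (x : coeffs R) (p q : nat -> R) :
  ((\col_(i < 9 + 12) p i)^T *m F_mx x *m (\col_(i < 9 + 12) q i)) 0 0
    = F_form x p q.
Proof.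
have colE (r : nat -> R) : \col_(i < 9 + 12) r i =
    col_mx (\col_(i < 9) r i) (\col_(i < 12) r (9 + i)%N).
  apply/matrixP => i j; rewrite mxE.
  by case: (split_ordP i) => k ->; rewrite ?col_mxEu ?col_mxEd mxE.
rewrite !colE tr_col_mx /F_mx mul_row_block !mulmx0 addr0 add0r mul_row_col.
rewrite [LHS]mxE; case: x => ???????????????????.
rewrite /A_mx /B_mx (symmx_formE _ _ p q).
rewrite (symmx_formE _ _ (fun i => p (9 + i)%N) (fun i => q (9 + i)%N)).
rewrite unlock /=.
rewrite /F_form /symblk3 /blk3 /=.
ring.
Qed.

(** * Seven orthogonal invariants *)

Definition dilat (R : realType) (C : elast R) : 'M[R]_3 :=
  \matrix_(i, j) \sum_k C (i, j, k, k).

Definition voigt_tensor (R : realType) (C : elast R) : 'M[R]_3 :=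
  \matrix_(i, j) \sum_k C (i, k, j, k).

Definition sqnorm (R : realType) (C : elast R) : R :=
  \sum_(x : 'I_3 * 'I_3) \sum_(y : 'I_3 * 'I_3) C (x.1, x.2, y.1, y.2) ^+ 2.

(** The transposes make the last traces Frobenius products, which simultaneous orthogonal
    conjugation of any two matrices preserves. *)
Definition invariants (R : realType) (C : elast R) : seq R :=
  let a := dilat C in let b := voigt_tensor C in
  [:: \tr a ^+ 2; \tr a * \tr b; \tr b ^+ 2;
      \tr (a *m a^T); \tr (a *m b^T); \tr (b *m b^T); sqnorm C].

Lemma conj_mxE (R : comPzRingType) (Q Y : 'M[R]_3) i j :
  (Q *m Y *m Q^T) i j = \sum_p \sum_q Q i p * Q j q * Y p q.
Proof.
rewrite mxE exchange_big; apply: eq_bigr => q _ /=.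
by rewrite !mxE mulr_suml; apply: eq_bigr => p _; rewrite mulrAC.
Qed.

(** The columns of [Q] are orthonormal, so two factors of [Q] sharing a summed row index collapse to
    a Kronecker delta. *)
Lemma sum_orthogonal (R : realType) (Q : 'M[R]_3) (g : 'I_3 -> 'I_3 -> R) :
  Q^T *m Q = 1%:M ->
  \sum_k \sum_r \sum_s Q k r * Q k s * g r s = \sum_r g r r.
Proof.
move=> orthQ; have gram r s : \sum_k Q k r * Q k s = (r == s)%:R.
  have /matrixP/(_ r s) := orthQ; rewrite !mxE => <-.
  by apply: eq_bigr => k _; rewrite mxE.
rewrite exchange_big; apply: eq_bigr => r _ /=; rewrite exchange_big /=.
under eq_bigr do rewrite -mulr_suml gram.
rewrite (bigD1 r) //= eqxx mul1r big1 ?addr0 // => s /negPf.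
by rewrite eq_sym => ->; rewrite mul0r.
Qed.

(** Of the four factors of [Q], the two on the contracted indices cancel by [sum_orthogonal]; the
    other two form the conjugation. *)
Lemma dilat_act (R : realType) (Q : 'M[R]_3) (C : elast R) :
  Q^T *m Q = 1%:M -> dilat (act Q C) = Q *m dilat C *m Q^T.
Proof.
move=> orthQ; apply/matrixP => i j; rewrite conj_mxE mxE.
under eq_bigr do rewrite ffunE.
rewrite exchange_big; apply: eq_bigr => p _ /=.
rewrite exchange_big; apply: eq_bigr => q _ /=.
rewrite mxE -(sum_orthogonal (fun r s => C (p, q, r, s)) orthQ) mulr_sumr.
apply: eq_bigr => k _.
rewrite mulr_sumr; apply: eq_bigr => r _; rewrite mulr_sumr.
by apply: eq_bigr => s _; rewrite !mulrA.
Qed.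

Lemma voigt_tensor_act (R : realType) (Q : 'M[R]_3) (C : elast R) :
  Q^T *m Q = 1%:M -> voigt_tensor (act Q C) = Q *m voigt_tensor C *m Q^T.
Proof.
move=> orthQ; apply/matrixP => i j; rewrite conj_mxE mxE.
under eq_bigr do rewrite ffunE.
rewrite exchange_big; apply: eq_bigr => p _ /=.
under eq_bigr do rewrite exchange_big.
rewrite exchange_big; apply: eq_bigr => r _ /=.
rewrite mxE -(sum_orthogonal (fun q s => C (p, q, r, s)) orthQ) mulr_sumr.
apply: eq_bigr => k _.
rewrite mulr_sumr; apply: eq_bigr => q _; rewrite mulr_sumr.
by apply: eq_bigr => s _; rewrite !mulrA [Q i p * _ * _]mulrAC.
Qed.

Lemma frob_trE (R : pzRingType) (n : nat) (Y : 'M[R]_n) :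
  \sum_(x : 'I_n * 'I_n) Y x.1 x.2 ^+ 2 = \tr (Y *m Y^T).
Proof.
rewrite -(pair_bigA _ (fun i j => Y i j ^+ 2)); apply: eq_bigr => i _ /=.
by rewrite mxE; apply: eq_bigr => j _; rewrite mxE expr2.
Qed.

Lemma tr_conj_orthogonal (R : comPzRingType) (n : nat) (Q Y : 'M[R]_n) :
  Q^T *m Q = 1%:M -> \tr (Q *m Y *m Q^T) = \tr Y.
Proof. by move=> orthQ; rewrite mxtrace_mulC mulmxA orthQ mul1mx. Qed.

Lemma tr_conj_mul_orthogonal (R : comPzRingType) (n : nat) (Q Y Z : 'M[R]_n) :
  Q^T *m Q = 1%:M ->
  \tr (Q *m Y *m Q^T *m (Q *m Z *m Q^T)^T) = \tr (Y *m Z^T).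
Proof.
move=> orthQ; rewrite !trmx_mul trmxK -(tr_conj_orthogonal (Y *m Z^T) orthQ).
by rewrite !mulmxA -[X in \tr (X *m _ *m _)]mulmxA orthQ mulmx1.
Qed.

(** Conjugation by [Q] preserves the Frobenius norm. This is applied twice: to the first index pair
    with the second fixed, then to the second pair. *)
Lemma sqnorm_act (R : realType) (Q : 'M[R]_3) (C : elast R) :
  Q^T *m Q = 1%:M -> sqnorm (act Q C) = sqnorm C.
Proof.
move=> orthQ.
have frob Y : \sum_(x : 'I_3 * 'I_3) (Q *m Y *m Q^T) x.1 x.2 ^+ 2
    = \sum_(x : 'I_3 * 'I_3) Y x.1 x.2 ^+ 2.
  by rewrite !frob_trE tr_conj_mul_orthogonal.
pose X p q : 'M[R]_3 := \matrix_(r, s) C (p, q, r, s).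
pose Y k l : 'M[R]_3 := \matrix_(p, q) (Q *m X p q *m Q^T) k l.
have actE i j k l : act Q C (i, j, k, l) = (Q *m Y k l *m Q^T) i j.
  rewrite conj_mxE ffunE; apply: eq_bigr => p _; apply: eq_bigr => q _.
  rewrite mxE conj_mxE mulr_sumr; apply: eq_bigr => r _; rewrite mulr_sumr.
  by apply: eq_bigr => s _; rewrite mxE !mulrA.
rewrite /sqnorm exchange_big /=.
under eq_bigr => y _ do
  [under eq_bigr do rewrite actE; rewrite (frob (Y y.1 y.2))].
rewrite exchange_big; apply: eq_bigr => x _ /=.
under eq_bigr do rewrite mxE.
by rewrite frob; apply: eq_bigr => y _; rewrite mxE.
Qed.

Lemma invariants_act (R : realType) (Q : 'M[R]_3) (C : elast R) :
  Q^T *m Q = 1%:M -> invariants (act Q C) = invariants C.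
Proof.
move=> orthQ; rewrite /invariants dilat_act // voigt_tensor_act // sqnorm_act //.
by rewrite !tr_conj_orthogonal // !tr_conj_mul_orthogonal.
Qed.

(** * Solutions of the conditions as combinations of the invariants *)

Definition invariant_coeffs (R : realType) (a : nat -> R) : coeffs R :=
  {| f11 := a 0 + a 1 + a 2 + a 3 + a 4 + a 5 + a 6;
     f12 := a 0 + a 1 + a 2;
     f14 := 2 * a 0 + a 1;
     f15 := 2 * a 0 + a 1 + a 3 + a 4 / 2;
     f17 := a 1 + 2 * a 2;
     f18 := a 1 + 2 * a 2 + a 4 / 2 + a 5;
     f44 := 4 * a 0 + 2 * a 3 + 2 * a 6;
     f45 := 4 * a 0 + a 3;
     f47 := 2 * a 1 + a 4;
     f48 := 2 * a 1 + a 4 / 2;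
     f77 := 4 * a 2 + 2 * a 5 + 4 * a 6;
     f78 := 4 * a 2 + a 5;
     b11 := 2 * a 3 + 4 * a 6;
     b14 := 2 * a 3 + a 4;
     b1_10 := a 4;
     b44 := 2 * a 3 + 2 * a 4 + 2 * a 5 + 4 * a 6;
     b47 := 2 * a 3 + 2 * a 4 + 2 * a 5;
     b4_10 := a 4 + 2 * a 5;
     b10_10 := 2 * a 5 + 8 * a 6 |}%N.

Lemma invariant_coeffsE (R : realType) (a : nat -> R) (C : elast R) :
  F_form (invariant_coeffs a) (modulus C) (modulus C)
    = \sum_(i < 7) a i * nth 0 (invariants C) i.
Proof.
rewrite -(big_mkord xpredT (fun i => a i * nth 0 (invariants C) i)) unlock /=.
rewrite /mxtrace /sqnorm.
rewrite -(pair_bigA _ (fun i j => \sum_(y : 'I_3 * 'I_3) C (i, j, y.1, y.2) ^+ 2)).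
under [X in _ * X + 0]eq_bigr => i _ do under eq_bigr => j _ do
  rewrite -(pair_bigA _ (fun k l => C (i, j, k, l) ^+ 2)).
rewrite !sum3 /= !mxE !sum3 !mxE !sum3.
have pairCl k l : ((C (1, 0, k, l) = C (0, 1, k, l)) *
    (C (2, 1, k, l) = C (1, 2, k, l)) * (C (0, 2, k, l) = C (2, 0, k, l)))%type.
  by have [-> _ _] := elast_symE C 0 1 k l; have [-> _ _] := elast_symE C 1 2 k l;
    have [-> _ _] := elast_symE C 2 0 k l.
have pairCr i j : ((C (i, j, 1, 0) = C (i, j, 0, 1)) *
    (C (i, j, 2, 1) = C (i, j, 1, 2)) * (C (i, j, 0, 2) = C (i, j, 2, 0)))%type.
  by have [_ -> _] := elast_symE C i j 0 1; have [_ -> _] := elast_symE C i j 1 2;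
    have [_ -> _] := elast_symE C i j 2 0.
have majorC i j k l : C (k, l, i, j) = C (i, j, k, l).
  by have [] := elast_symE C i j k l.
(* One instance of [majorC] for each of the fifteen pairs of distinct Voigt labels: the general
   equation would rewrite back and forth forever. *)
rewrite !(pairCl, pairCr, majorC 0 0 1 1, majorC 0 0 2 2, majorC 1 1 2 2).
rewrite !(majorC 0 0 1 2, majorC 0 0 2 0, majorC 0 0 0 1, majorC 1 1 1 2).
rewrite !(majorC 1 1 2 0, majorC 1 1 0 1, majorC 2 2 1 2, majorC 2 2 2 0).
rewrite !(majorC 2 2 0 1, majorC 1 2 2 0, majorC 1 2 0 1, majorC 2 0 0 1).
rewrite /F_form /symblk3 /blk3 /modulus /voigt /=.
by field.
Qed.

Lemma conditionsP (R : realType) (x : coeffs R) :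
  (forall i, tnth (conditions x) i = 0) -> exists a, x = invariant_coeffs a.
Proof.
move=> cond; have eqn n (ltn : (n < 12)%N) : nth 0 (conditions x) n = 0.
  by have := cond (Ordinal ltn); rewrite (tnth_nth 0).
move: (eqn 0 isT) (eqn 1 isT) (eqn 2 isT) (eqn 3 isT)%N.
move: (eqn 4 isT) (eqn 5 isT) (eqn 6 isT) (eqn 7 isT)%N.
move: (eqn 8 isT) (eqn 9 isT) (eqn 10 isT) (eqn 11 isT)%N.
case: x {cond eqn} => c11 c12 c14 c15 c17 c18 c44 c45 c47 c48 c77 c78.
move=> d11 d14 d1_10 d44 d47 d4_10 d10_10 /= e8 e9 e10 e11 e4 e5 e6 e7 e0 e1 e2 e3.
(* The weights are found by inverting [invariant_coeffs]: [b1_10] is [a 4], then [b14] and [b4_10]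
   give [a 3] and [a 5], and [f45], [f48], [f78], [b10_10] give [a 0], [a 1], [a 2], [a 6]. *)
pose a3 := (d14 - d1_10) / 2; pose a5 := (d4_10 - d1_10) / 2.
exists (nth 0 [:: (c45 - a3) / 4; (c48 - d1_10 / 2) / 2; (c78 - a5) / 4;
                  a3; d1_10; a5; (d10_10 - 2 * a5) / 8]).
by rewrite /a3 /a5 /invariant_coeffs; congr Coeffs => /=; lra.
Qed.

(** * Symmetrised words and the standard basis *)

(* The word (i, j, k, l) stands for the tensor product of the vectors d i, d j,
   d k and d l, which sym_word symmetrises over the eight index symmetries. *)
Definition word := ('I_3 * 'I_3 * 'I_3 * 'I_3)%type.

Definition sym_word (R : pzRingType) (d : 'I_3 -> 'I_3 -> R) (w x : word) : R :=
  let: (a, b, c, e) := w in let: (i, j, k, l) := x in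
  d a i * d b j * d c k * d e l + d b i * d a j * d c k * d e l
  + d a i * d b j * d e k * d c l + d b i * d a j * d e k * d c l
  + (d c i * d e j * d a k * d b l + d e i * d c j * d a k * d b l
  + d c i * d e j * d b k * d a l + d e i * d c j * d b k * d a l).

Lemma sym_word_elastic (R : realType) (d : 'I_3 -> 'I_3 -> R) (w : word) :
  [ffun x => sym_word d w x : R^o] \in @elastic_sym R.
Proof.
apply/elastic_symP => i j k l; rewrite !ffunE.
by case: w => [[[a b] c] e] /=; split; ring.
Qed.

Definition sym_tensor (R : realType) (d : 'I_3 -> 'I_3 -> R) (w : word) :=
  Elast (sym_word_elastic d w).

Definition weight (R : pzRingType) (s : 'I_3 -> R) (w : word) : R :=
  let: (a, b, c, e) := w in s a * s b * s c * s e.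

Lemma elastZE (R : realType) (a : R) (C : elast R) x : (a *: C) x = a * C x.
Proof. by rewrite -[(a *: C) x]/(val (a *: C) x) GRing.valZ ffunE. Qed.

Lemma elastDE (R : realType) (C D : elast R) x : (C + D) x = C x + D x.
Proof. by rewrite -[(C + D) x]/(val (C + D) x) raddfD ffunE. Qed.

(** A tensor product of vectors is moved factor by factor. Splitting off the scalars [s] allows [d']
    to be integral even when [Q] has irrational entries. *)
Lemma act_sym_tensor (R : realType) (Q : 'M[R]_3) (s : 'I_3 -> R)
    (d d' : 'I_3 -> 'I_3 -> R) (w : word) :
  (forall a i, \sum_p Q i p * d a p = s a * d' a i) ->
  act Q (sym_tensor d w) = weight s w *: sym_tensor d' w.
Proof.
move=> Qd; apply/val_inj/ffunP => -[[[i j] k] l].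
rewrite -[RHS]/((weight s w *: sym_tensor d' w) _) elastZE /= !ffunE.
pose S (f : 'I_3 -> 'I_3 -> 'I_3 -> 'I_3 -> R) := \sum_p \sum_q \sum_r \sum_t
  Q i p * Q j q * Q k r * Q l t * f p q r t.
have SD f g : S (fun p q r t => f p q r t + g p q r t) = S f + S g.
  rewrite -big_split; apply: eq_bigr => p _; rewrite -big_split.
  apply: eq_bigr => q _; rewrite -big_split; apply: eq_bigr => r _.
  by rewrite -big_split; apply: eq_bigr => t _; rewrite mulrDr.
have SM a b c e : S (fun p q r t => d a p * d b q * d c r * d e t)
    = s a * d' a i * (s b * d' b j) * (s c * d' c k) * (s e * d' e l).
  rewrite -!Qd -!mulrA [RHS]mulr_suml; apply: eq_bigr => p _.
  rewrite [X in _ * X]mulr_suml mulr_sumr; apply: eq_bigr => q _.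
  rewrite [X in _ * (_ * X)]mulr_suml !mulr_sumr; apply: eq_bigr => r _.
  by rewrite !mulr_sumr; apply: eq_bigr => t _; ring.
case: w => [[[a b] c] e].
transitivity (S (fun p q r t => sym_word d (a, b, c, e) (p, q, r, t))).
  by do 4![apply: eq_bigr => ? _]; rewrite ffunE.
by rewrite /sym_word !SD !SM /weight; ring.
Qed.

Definition word_orbit (w : word) : seq word :=
  let: (a, b, c, e) := w in
  [:: (a, b, c, e); (b, a, c, e); (a, b, e, c); (b, a, e, c);
      (c, e, a, b); (e, c, a, b); (c, e, b, a); (e, c, b, a)].

Lemma sym_tensor_orbit (R : realType) (d : 'I_3 -> 'I_3 -> R) (w w' : word) :
  w' \in word_orbit w -> sym_tensor d w' = sym_tensor d w.
Proof.
case: w => [[[a b] c] e]; rewrite !inE => ww'.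
apply/val_inj/ffunP => -[[[i j] k] l]; rewrite !ffunE.
by move: ww'; do 7?[case/orP]; move/eqP=> -> /=; ring.
Qed.

Definition word_at (n : nat) : word :=
  let: (K, L) := nth (0, 0)%N moduli_labels n in
  let: (i, j) := voigt_pair K in let: (k, l) := voigt_pair L in (i, j, k, l).

Lemma modulusE (R : realType) (C : elast R) n : modulus C n = C (word_at n).
Proof.
rewrite /modulus /voigt /word_at; case: nth => K L.
by case: voigt_pair => i j; case: voigt_pair.
Qed.

(** Integer vectors give integer components, so tables can be evaluated over [int] although [R] is
    abstract. *)
Lemma sym_word_int (R : realType) (d : 'I_3 -> 'I_3 -> int) (w x : word) :
  sym_word (fun a i => (d a i)%:~R : R) w x = (sym_word d w x)%:~R.
Proof.
case: w x => [[[a b] c] e] [[[i j] k] l] /=.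
by rewrite !rmorphD !rmorphM.
Qed.

Lemma modulus_sym_tensor (R : realType) (d : 'I_3 -> 'I_3 -> int) (w : word) n :
  modulus (sym_tensor (fun a i => (d a i)%:~R : R) w) n
    = (sym_word d w (word_at n))%:~R.
Proof. by rewrite modulusE ffunE sym_word_int. Qed.

Definition delta (a i : 'I_3) : int := (a == i).

Definition std_tensor (R : realType) (w : word) : elast R :=
  sym_tensor (fun a i => (delta a i)%:~R : R) w.

(** The number of the eight index symmetries that fix the word, since [sym_word delta w x] counts
    those carrying [w] to [x]. *)
Definition multiplicity (n : nat) : int := sym_word delta (word_at n) (word_at n).

Lemma modulus_std_tensor n m : (n < 21)%N -> (m < 21)%N ->
  (sym_word delta (word_at n) (word_at m) == 0) = (n != m).
Proof.
move=> ltn ltm.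
have : all (fun n => all (fun m =>
    (sym_word delta (word_at n) (word_at m) == 0) == (n != m)) (iota 0 21)) (iota 0 21).
  by vm_compute.
by move=> /allP/(_ n)/[!mem_iota]/(_ ltn)/allP/(_ m)/[!mem_iota]/(_ ltm)/eqP.
Qed.

(** The standard tensors are dual to the moduli up to [multiplicity], so both sides have the same
    moduli and [moduli_inj] applies. *)
Lemma elast_decomp (R : realType) (C : elast R) :
  C = \sum_(n < 9 + 12) (modulus C n / (multiplicity n)%:~R) *: std_tensor R (word_at n).
Proof.
apply: moduli_inj; apply/matrixP => m j; rewrite [LHS]mxE [RHS]mxE.
rewrite -/(modulus _ _) -/(modulus _ _).
have modZ a (D : elast R) n : modulus (a *: D) n = a * modulus D n.
  by rewrite !modulusE elastZE.
have modD n : {morph (fun C : elast R => modulus C n) : C D / C + D >-> C + D}.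
  by move=> D E; rewrite !modulusE elastDE.
have mod0 n : modulus (0 : elast R) n = 0.
  by rewrite -(scale0r (0 : elast R)) modZ mul0r.
rewrite (big_morph (fun C : elast R => modulus C m) (modD m) (mod0 m)).
rewrite (bigD1 m) //= big1 ?addr0 => [|n n'm]; rewrite modZ.
  rewrite modulus_sym_tensor divfK // intr_eq0.
  by rewrite modulus_std_tensor ?eqxx.
rewrite modulus_sym_tensor (eqP (_ : sym_word _ _ _ == 0)) ?mulr0 //.
by rewrite modulus_std_tensor.
Qed.

(** * Invariant symmetric bilinear forms and their Gram matrices *)

Record invariant_bilin (R : realType) (G : elast R -> elast R -> R) : Prop := {
  bilin_sym : forall C D, G C D = G D C;
  bilin_lin : forall a C D E, G (a *: C + D) E = a * G C E + G D E;
  bilin_act : forall Q, SO3 Q -> forall C D, G (act Q C) (act Q D) = G C D }.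

Definition gram (R : realType) (G : elast R -> elast R -> R) (n m : nat) : R :=
  G (std_tensor R (word_at n)) (std_tensor R (word_at m))
  / (multiplicity n * multiplicity m)%:~R.

Lemma bilin_scale (R : realType) (G : elast R -> elast R -> R) a b C D :
  invariant_bilin G -> G (a *: C) (b *: D) = a * b * G C D.
Proof.
case=> GC GL _.
have G0 E : G 0 E = 0 by have := GL 1 0 0 E; rewrite scaler0 addr0; lra.
have GZ c E E' : G (c *: E) E' = c * G E E'.
  by rewrite -[c *: E]addr0 GL G0 addr0.
by rewrite GZ GC GZ GC mulrA.
Qed.

Lemma bilin_suml (R : realType) (G : elast R -> elast R -> R) n
    (a : 'I_n -> R) (C : 'I_n -> elast R) D :
  invariant_bilin G -> G (\sum_i a i *: C i) D = \sum_i a i * G (C i) D.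
Proof.
case=> GC GL _; elim: n a C => [|n IHn] a C.
  by rewrite !big_ord0; have := GL 1 0 0 D; rewrite scaler0 addr0; lra.
by rewrite !big_ord_recl GL IHn.
Qed.

Lemma gram_expand (R : realType) (G : elast R -> elast R -> R) C D :
  invariant_bilin G ->
  G C D = \sum_(n < 9 + 12) \sum_(m < 9 + 12) modulus C n * modulus D m * gram G n m.
Proof.
move=> invG; rewrite {1}(elast_decomp C) bilin_suml //.
apply: eq_bigr => n _.
rewrite (bilin_sym invG) {1}(elast_decomp D) bilin_suml // mulr_sumr.
apply: eq_bigr => m _; rewrite (bilin_sym invG) /gram rmorphM invfM /=; ring.
Qed.

(** The common source of all relations between Gram entries: it is applied to half turns about the
    axes, to signed permutations and to [turn]. *)
Lemma bilin_weight (R : realType) (G : elast R -> elast R -> R) (Q : 'M[R]_3)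
    (s : 'I_3 -> R) (d d' : 'I_3 -> 'I_3 -> R) (w w' : word) :
  invariant_bilin G -> SO3 Q ->
  (forall a i, \sum_p Q i p * d a p = s a * d' a i) ->
  weight s w * weight s w' * G (sym_tensor d' w) (sym_tensor d' w')
    = G (sym_tensor d w) (sym_tensor d w').
Proof.
move=> invG SO3Q Qd; rewrite -[RHS](bilin_act invG SO3Q).
by rewrite !(act_sym_tensor _ Qd) bilin_scale.
Qed.

(** * Signed permutations: reduction to 19 Gram entries *)

Lemma weight_int (R : realType) (s : 'I_3 -> int) (w : word) :
  weight (fun a => (s a)%:~R : R) w = (weight s w)%:~R.
Proof. by case: w => [[[a b] c] e] /=; rewrite !rmorphM. Qed.

Lemma sum_delta (R : realType) (f : 'I_3 -> R) (a : 'I_3) :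
  \sum_p f p * (delta a p)%:~R = f a.
Proof.
rewrite (bigD1 a) //= /delta eqxx mulr1 big1 ?addr0 // => p /negPf.
by rewrite eq_sym => ->; rewrite mulr0.
Qed.

(** The diagonal of the half turn about axis [a]. It is minus the reflection reversing that axis,
    hence acts on fourth-order tensors as that reflection. *)
Definition half_turn (a i : 'I_3) : int := if i == a then 1 else -1.

Lemma half_turn_SO3 (R : realType) (a : 'I_3) :
  SO3 (diag_mx (\row_i (half_turn a i)%:~R) : 'M[R]_3).
Proof.
split.
  rewrite tr_diag_mx mulmx_diag -[RHS]diag_const_mx; congr diag_mx.
  apply/rowP => i; rewrite !mxE /half_turn.
  by case: eqP; rewrite ?mulr1 ?mulrNN ?mulr1.
rewrite det_diag big_ord_recl !big_ord_recl big_ord0 !mxE.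
by move: a; apply: ord3P; rewrite /half_turn /=; ring.
Qed.

Lemma gram_odd (R : realType) (G : elast R -> elast R -> R) n m a :
  invariant_bilin G ->
  weight (half_turn a) (word_at n) * weight (half_turn a) (word_at m) = -1 ->
  gram G n m = 0.
Proof.
move=> invG wt; rewrite /gram; suff -> : G (std_tensor R (word_at n))
  (std_tensor R (word_at m)) = 0 by rewrite mul0r.
have Qd b i : \sum_p (diag_mx (\row_j (half_turn a j)%:~R) : 'M[R]_3) i p
    * (delta b p)%:~R = (half_turn a b)%:~R * (delta b i)%:~R.
  rewrite sum_delta !mxE /delta eq_sym.
  by case: eqVneq => [->|_]; rewrite ?mulr1n ?mulr1 ?mulr0n ?mulr0.
have := bilin_weight (word_at n) (word_at m) invG (half_turn_SO3 R a) Qd.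
rewrite !weight_int -rmorphM /= wt /std_tensor; lra.
Qed.

Definition map_word (f : 'I_3 -> 'I_3) (w : word) : word :=
  let: (a, b, c, e) := w in (f a, f b, f c, f e).

Lemma bilin_perm (R : realType) (G : elast R -> elast R -> R)
    (f : 'I_3 -> 'I_3) (w w' : word) :
  invariant_bilin G -> injective f ->
  G (std_tensor R (map_word f w)) (std_tensor R (map_word f w'))
    = G (std_tensor R w) (std_tensor R w').
Proof.
move=> invG injf; pose s := perm injf; pose sgn : R := (-1) ^+ s.
have sgn2 : sgn * sgn = 1 by rewrite -expr2 sqrr_sign.
(* The sign gives determinant 1 for odd permutations too, and the transpose makes [Q] send e_a to
   plus or minus e_(f a). Over four letters the sign disappears. *)
pose Q : 'M[R]_3 := sgn *: (perm_mx s)^T.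
have SO3Q : SO3 Q.
  split.
    rewrite /Q linearZ /= trmxK -scalemxAl -scalemxAr scalerA sgn2 scale1r.
    by rewrite tr_perm_mx -perm_mxM mulVg perm_mx1.
  by rewrite /Q detZ det_tr det_perm !exprS expr0 mulr1 sgn2 mulr1 sgn2.
pose d' a i : R := (delta (f a) i)%:~R.
have Qd a i : \sum_p Q i p * (delta a p)%:~R = sgn * d' a i.
  by rewrite sum_delta !mxE permE /d' /delta.
rewrite -(bilin_weight w w' invG SO3Q Qd).
have weight1 v : weight (fun=> sgn) v = 1.
  by case: v => [[[? ?] ?] ?] /=; rewrite sgn2 mul1r sgn2.
rewrite !weight1 !mul1r.
have std_map v : sym_tensor d' v = std_tensor R (map_word f v).
  by case: v => [[[a b] c] e]; apply/val_inj/ffunP => x; rewrite !ffunE.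
by rewrite !std_map.
Qed.

(** Explicit value tables, so that [gram_conj] can be evaluated. *)
Definition index_perms : seq ('I_3 -> 'I_3) :=
  [seq (fun i : 'I_3 => nth 0 s i) | s <-
    [:: [:: 0; 1; 2]; [:: 1; 0; 2]; [:: 0; 2; 1];
        [:: 2; 1; 0]; [:: 1; 2; 0]; [:: 2; 0; 1]]].

Lemma index_perms_inj k : injective (nth id index_perms k).
Proof.
(* Past the six tables [nth] returns its default [id], which is injective as well. *)
by do 6?[case: k => [|k] /=]; [..|case: k => [|k] //=];
  do 2![apply: ord3P].
Qed.

Definition gram_conj (n m n' m' : nat) : bool :=
  has (fun f => (word_at n' \in word_orbit (map_word f (word_at n)))
             && (word_at m' \in word_orbit (map_word f (word_at m)))) index_perms
  && (multiplicity n * multiplicity m == multiplicity n' * multiplicity m').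

Lemma gram_conjE (R : realType) (G : elast R -> elast R -> R) n m n' m' :
  invariant_bilin G -> gram_conj n m n' m' -> gram G n' m' = gram G n m.
Proof.
move=> invG /andP[/(has_nthP id)[k _ /andP[nn' mm']] /eqP mult].
rewrite /gram /std_tensor (sym_tensor_orbit _ nn') (sym_tensor_orbit _ mm').
rewrite -mult; congr (_ / _).
exact: (bilin_perm _ _ invG (@index_perms_inj k)).
Qed.

(* The entry of the Gram matrix representing the orbit of (n, m), or None when a
   sign change kills it; the moduli come in seven blocks of three, permuted alike
   by the axes up to the index symmetries. *)
Definition gram_rep (n m : nat) : option (nat * nat) :=
  let: (bn, i) := edivn n 3 in let: (bm, j) := edivn m 3 in
  let: (b, b') := if (bn <= bm)%N then (bn, bm) else (bm, bn) in
  let start := nth 0%N [:: 0; 3; 6; 9; 12; 15; 18]%N in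
  if (b' < 3)%N then
    Some (start b, if i == j then start b' else (start b').+1)
  else if (2 < b)%N && (i == j) then
    Some match (b, b')%N with
         | (5, 5) => (12, 12) | (5, 6) => (12, 18) | (3, 5) => (9, 12)
         | _ => (start b, start b')
         end%N
  else None.

Lemma gram_repE (R : realType) (G : elast R -> elast R -> R) n m :
  invariant_bilin G -> (n < 21)%N -> (m < 21)%N ->
  gram G n m = if gram_rep n m is Some (n', m') then gram G n' m' else 0.
Proof.
move=> invG ltn ltm.
(* All 441 entries are settled by evaluation. The test with [n] and [m] exchanged relies on the
   symmetry of [G]. *)
have : all (fun n => all (fun m =>
    if gram_rep n m is Some (n', m') then gram_conj n' m' n m || gram_conj n' m' m n
    else has (fun a => weight (half_turn a) (word_at n)
                     * weight (half_turn a) (word_at m) == -1) [:: 0; 1; 2])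
    (iota 0 21)) (iota 0 21).
  by vm_compute.
move=> /allP/(_ n)/[!mem_iota]/(_ ltn)/allP/(_ m)/[!mem_iota]/(_ ltm).
case: gram_rep => [[n' m']|] => [/orP[] /(gram_conjE invG)//|/hasP[a _ /eqP]].
  by rewrite /gram (bilin_sym invG) [(multiplicity n * _)%R]mulrC.
exact: gram_odd.
Qed.

(** Each coefficient is read at the representative that [gram_rep] assigns to its orbit; positions
    count from 0. *)
Definition gram_coeffs (R : realType) (G : elast R -> elast R -> R) : coeffs R :=
  Coeffs (gram G 0 0) (gram G 0 1) (gram G 0 3) (gram G 0 4) (gram G 0 6)
    (gram G 0 7) (gram G 3 3) (gram G 3 4) (gram G 3 6) (gram G 3 7)
    (gram G 6 6) (gram G 6 7) (gram G 9 9) (gram G 9 12) (gram G 9 18)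
    (gram G 12 12) (gram G 12 15) (gram G 12 18) (gram G 18 18).

Lemma gram_formE (R : realType) (G : elast R -> elast R -> R) C D :
  invariant_bilin G ->
  G C D = F_form (gram_coeffs G) (modulus C) (modulus D).
Proof.
move=> invG; rewrite (gram_expand _ _ invG).
pose M n m := if gram_rep n m is Some (n', m') then gram G n' m' else 0.
transitivity (\sum_(n <- iota 0 21) \sum_(m <- iota 0 21)
    modulus C n * modulus D m * M n m).
  rewrite -[iota 0 21]/(index_iota 0 (9 + 12)) big_mkord; apply: eq_bigr => n _.
  by rewrite big_mkord; apply: eq_bigr => m _; rewrite gram_repE.
rewrite unlock /M /gram_coeffs.
move: (gram G) (modulus C) (modulus D) => g p q /=.
rewrite /F_form /symblk3 /blk3 /=.
ring.
Qed.

(** * The half turn and the twelve conditions *)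

(* The images of e_1, e_2, e_3 under the half turn are e_1 + e_2, e_1 - e_2 and
   e_3, scaled by turn_scale. *)
Definition turned (a i : 'I_3) : int :=
  nth 0 (nth [::] [:: [:: 1; 1; 0]; [:: 1; -1; 0]; [:: 0; 0; 1]] a) i.

Definition turn_scale (R : realType) (a : 'I_3) : R :=
  - (- Num.sqrt 2^-1) ^+ (a != 2).

Definition turn (R : realType) : 'M[R]_3 :=
  \matrix_(i, p) (turn_scale R p * (turned p i)%:~R).

Lemma sqrt_half (R : realType) : Num.sqrt (2^-1 : R) * Num.sqrt 2^-1 = 2^-1.
Proof. by rewrite -expr2 sqr_sqrtr // invr_ge0. Qed.

Lemma turn_SO3 (R : realType) : SO3 (turn R).
Proof.
have turnE i p : turn R i p = turn_scale R p * (turned p i)%:~R by rewrite mxE.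
have h2 := sqrt_half R; rewrite /turn_scale in turnE.
(* The square root becomes a variable [h] known only through [h * h = 2^-1], which suffices for
   linear arithmetic over monomials. *)
move: (turn R) (Num.sqrt 2^-1) h2 turnE => Q h h2 turnE; split.
  by apply/matrixP; do 2![apply: ord3P];
    rewrite !mxE sum3 !mxE !turnE /turned /=; lra.
rewrite (expand_det_row _ 2) sum3 /cofactor !(expand_det_row _ 0).
rewrite !big_ord_recl !big_ord0 /cofactor.
rewrite !det_mx11 !mxE !turnE /turned /=.
rewrite -[((1 %% 3 + 1 %% 3) %% 3)%N]/2%N -[(1 %% 3)%N]/1%N /bump /=.
by rewrite !exprS !expr0; lra.
Qed.

Definition plane_count (w : word) : nat :=
  let: (a, b, c, e) := w in (a != 2) + (b != 2) + (c != 2) + (e != 2).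

(** Over four letters the outer signs of [turn_scale] cancel, leaving a power of [- Num.sqrt 2^-1];
    an even total exponent makes it rational. *)
Lemma weight_turn (R : realType) (w w' : word) :
  ~~ odd (plane_count w + plane_count w') ->
  weight (turn_scale R) w * weight (turn_scale R) w'
    = 2^-1 ^+ (plane_count w + plane_count w')./2.
Proof.
have weightE v : weight (turn_scale R) v = (- Num.sqrt 2^-1) ^+ plane_count v.
  by case: v => [[[a b] c] e]; rewrite /= /turn_scale !exprD !(mulrN, mulNr) !opprK.
move=> even_ww'; rewrite !weightE -exprD -[in LHS](even_halfK even_ww').
by rewrite -mul2n exprM expr2 mulrNN sqrt_half.
Qed.

Definition word_moduli (d : 'I_3 -> 'I_3 -> int) (w : word) : seq int :=
  [seq sym_word d w (word_at n) | n <- iota 0 21].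

Lemma modulus_word_moduli (R : realType) (d : 'I_3 -> 'I_3 -> int) (w : word) n :
  (n < 21)%N ->
  modulus (sym_tensor (fun a i => (d a i)%:~R : R) w) n = ((word_moduli d w)`_n)%:~R.
Proof.
move=> ltn; rewrite modulus_sym_tensor (nth_map 0%N) ?size_iota //.
by rewrite nth_iota.
Qed.

(** For concrete words this is one linear equation with rational coefficients in the 19 entries of
    [gram_coeffs G]. *)
Lemma gram_turn (R : realType) (G : elast R -> elast R -> R) (w w' : word) :
  invariant_bilin G -> ~~ odd (plane_count w + plane_count w') ->
  2^-1 ^+ (plane_count w + plane_count w')./2 *
    F_form (gram_coeffs G) (fun n => ((word_moduli turned w)`_n)%:~R)
                           (fun n => ((word_moduli turned w')`_n)%:~R)
  = F_form (gram_coeffs G) (fun n => ((word_moduli delta w)`_n)%:~R)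
                           (fun n => ((word_moduli delta w')`_n)%:~R).
Proof.
move=> invG even_ww'.
have Qd a i : \sum_p turn R i p * (delta a p)%:~R
    = turn_scale R a * (turned a i)%:~R.
  by rewrite sum_delta mxE.
have := bilin_weight w w' invG (turn_SO3 R) Qd.
rewrite weight_turn // !gram_formE //.
by rewrite /F_form /symblk3 /blk3 !modulus_word_moduli.
Qed.

Ltac word_equation :=
  repeat match goal with |- context [word_moduli ?d ?v] =>
    let t := eval vm_compute in (word_moduli d v) in
    change (word_moduli d v) with t
  end;
  rewrite /F_form /symblk3 /blk3 /=; lra.

Lemma gram_conditions (R : realType) (G : elast R -> elast R -> R) i :
  invariant_bilin G -> tnth (conditions (gram_coeffs G)) i = 0.
Proof.
move=> invG; have turnG w w' := @gram_turn R G w w' invG.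
case: (gram_coeffs G) turnG {invG} => [c11 c12 c14 c15 c17 c18 c44 c45 c47 c48].
move=> c77 c78 d11 d14 d1_10 d44 d47 d4_10 d10_10 turnG.
(* Each relation comes from rotating one pair of words, with the earlier relations at hand. Eight of
   them are conditions up to rearrangement; [e5], [e10], [e11] and [e12] combine with these into the
   other four. *)
have e1 : 2 * c12 = c14 + c17.
  by move: (turnG (0, 0, 0, 0) (2, 2, 2, 2) isT); word_equation.
have e2 : 2 * c44 - 2 * c45 = d11.
  by move: (turnG (1, 1, 2, 2) (1, 1, 2, 2) isT); word_equation.
have e3 : 2 * c47 - 2 * c48 = d1_10.
  by move: (turnG (1, 1, 2, 2) (1, 2, 1, 2) isT); word_equation.
have e4 : 2 * c77 - 2 * c78 = d10_10.
  by move: (turnG (1, 2, 1, 2) (1, 2, 1, 2) isT); word_equation.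
have e5 : d47 = d14 + d4_10.
  by move: (turnG (0, 0, 1, 2) (2, 2, 1, 2) isT); word_equation.
have e6 : 2 * c14 - 2 * c15 = - d14.
  by move: (turnG (2, 2, 0, 1) (1, 1, 0, 1) isT); word_equation.
have e7 : 2 * c17 - 2 * c18 = - d4_10.
  by move: (turnG (1, 1, 0, 1) (1, 2, 2, 0) isT); word_equation.
have e8 : c14 + c15 = c45 + c48.
  by move: (turnG (1, 1, 2, 2) (0, 0, 1, 1) isT); word_equation.
have e9 : c17 + c18 = c48 + c78.
  by move: (turnG (0, 0, 1, 1) (1, 2, 1, 2) isT); word_equation.
have e10 : d44 + d11 = 2 * d14 + d10_10.
  by move: (turnG (0, 0, 1, 2) (1, 1, 1, 2) isT); word_equation.
have e11 : d44 = d11 + d1_10 + d4_10.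
  by move: (turnG (0, 0, 1, 2) (2, 0, 0, 1) isT); word_equation.
have e12 : 4 * c11 - 4 * c12 = d44 + d47.
  by move: (turnG (1, 1, 0, 1) (1, 1, 0, 1) isT); word_equation.
clear turnG; rewrite (tnth_nth 0); case: i => n /=.
by do 12?[case: n => [|n] //=]; move=> _; lra.
Qed.

(** * Passage between quadratic and bilinear forms *)

Lemma act_additive (R : realType) (Q : 'M[R]_3) (C D : elast R) :
  act Q (C + D) = act Q C + act Q D.
Proof.
apply/val_inj/ffunP => -[[[i j] k] l].
rewrite -[RHS]/((act Q C + act Q D) _) elastDE /= !ffunE.
rewrite -big_split; apply: eq_bigr => p _; rewrite -big_split.
apply: eq_bigr => q _; rewrite -big_split; apply: eq_bigr => r _.
by rewrite -big_split; apply: eq_bigr => s _; rewrite elastDE mulrDr.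
Qed.

(** The form [b] itself may be neither symmetric nor invariant, but [b C D + b D C] equals
    [phi (C + D) - phi C - phi D], which inherits the invariance of [phi]. *)
Lemma polar_invariant (R : realType) (phi : elast R -> R^o)
    (b : {biscalar (elast R)}) :
  (forall C, phi C = b C C) -> invariant_under (@SO3 R) phi ->
  invariant_bilin (fun C D => (b C D + b D C) / 2).
Proof.
move=> phiE inv_phi; split=> [C D|a C D E|Q SO3Q C D]; first by rewrite addrC.
  by rewrite linearPl linearPr /=; field.
congr (_ / 2); have := inv_phi Q SO3Q (C + D).
have := inv_phi Q SO3Q C; have := inv_phi Q SO3Q D.
by rewrite !phiE act_additive !linearDl !linearDr /=; lra.
Qed.

Lemma modulus_linear (R : realType) a (C D : elast R) n :
  modulus (a *: C + D) n = a * modulus C n + modulus D n.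
Proof. by rewrite !modulusE elastDE elastZE. Qed.

Definition F_bilin (R : realType) (x : coeffs R) (C D : elast R) : R :=
  F_form x (modulus C) (modulus D).

Lemma F_bilin_is_bilinear (R : realType) (x : coeffs R) :
  bilinear_for (GRing.Scale.Law.clone _ _ *%R _) (GRing.Scale.Law.clone _ _ *%R _)
    (F_bilin x).
Proof.
by split=> E a C D; rewrite /F_bilin /F_form /symblk3 /blk3 !modulus_linear /=; ring.
Qed.

HB.instance Definition _ (R : realType) (x : coeffs R) :=
  bilinear_isBilinear.Build R (elast R) (elast R) R _ _ (F_bilin x)
    (F_bilin_is_bilinear x).

Lemma F_quadratic (R : realType) (x : coeffs R) (phi : elast R -> R^o) :
  (forall C, phi C = F_form x (modulus C) (modulus C)) -> quadratic_form phi.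
Proof. by move=> phiE; exists (F_bilin x). Qed.

Lemma F_invariant (R : realType) (a : nat -> R) (phi : elast R -> R^o) :
  (forall C, phi C = F_form (invariant_coeffs a) (modulus C) (modulus C)) ->
  invariant_under (@SO3 R) phi.
Proof.
move=> phiE Q [/mulmx1C orthQ _] C.
by rewrite !phiE !invariant_coeffsE invariants_act.
Qed.

Lemma invariant_F_form (R : realType) (phi : elast R -> R^o) :
  quadratic_form phi -> invariant_under (@SO3 R) phi ->
  exists2 x : coeffs R, (forall i, tnth (conditions x) i = 0) &
    forall C, phi C = F_form x (modulus C) (modulus C).
Proof.
move=> [b phiE] /(polar_invariant phiE) invG.
exists (gram_coeffs (fun C D => (b C D + b D C) / 2)) => [i|C].
  exact: gram_conditions.
by rewrite -gram_formE // phiE; field.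
Qed.

Lemma moduli_F_mxE (R : realType) (x : coeffs R) (C : elast R) :
  ((moduli C)^T *m F_mx x *m moduli C) 0 0 = F_form x (modulus C) (modulus C).
Proof. by rewrite moduliE F_mxE. Qed.

(** * Linear independence and dimension *)

Lemma conditions_lin_indep (R : realType) :
  lin_indep (fun (i : 'I_12) =>
    ((fun x : coeffs R => tnth (conditions x) i) : coeffs R -> R^o)).
Proof.
move=> a sum0; pose c n := a (inord n).
have eqn x : \sum_(0 <= n < 12) c n * (conditions x)`_n = 0.
  rewrite big_mkord; have := congr1 (@^~ x) sum0; rewrite fct_sumE => sum0x.
  by apply: etrans sum0x; apply: eq_bigr => n _; rewrite /c inord_val -tnth_nth.
suff c0 n : (n < 12)%N -> c n = 0.
  by move=> i; rewrite -[i]inord_val -/(c i) c0.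
pose unit_coeffs (k : nat) := let e (n : nat) : R := (n == k)%:R in
  (Coeffs (e 0) (e 1) (e 2) (e 3) (e 4) (e 5) (e 6) (e 7) (e 8) (e 9) (e 10)
    (e 11) (e 12) (e 13) (e 14) (e 15) (e 16) (e 17) (e 18))%N.
have {}eqn k := eqn (unit_coeffs k).
(* Each of the seven [b] coefficients (positions 12 to 18) occurs in a single condition, which kills
   the last seven weights. Then [f77], [f47], [f17], [f45] and [f78] kill the first five. *)
move: (eqn 12) (eqn 13) (eqn 14) (eqn 15) (eqn 16) (eqn 17) (eqn 18)%N.
move: (eqn 10) (eqn 8) (eqn 4) (eqn 7) (eqn 11)%N.
rewrite unlock /= => e1 e2 e3 e4 e5 e6 e7 e8 e9 e10 e11 e12.
by do 12?[case: n => [|n] //]; move=> _; lra.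
Qed.

Lemma invariants_lin_indep (R : realType) :
  lin_indep (fun i : 'I_7 => (fun C : elast R => (invariants C)`_i : R^o)).
Proof.
move=> a sum0; pose c n := a (inord n).
have form0 C : F_form (invariant_coeffs c) (modulus C) (modulus C) = 0.
  rewrite invariant_coeffsE; have := congr1 (@^~ C) sum0; rewrite fct_sumE => sum0x.
  by apply: etrans sum0x; apply: eq_bigr => n _; rewrite /c inord_val.
suff c0 n : (n < 7)%N -> c n = 0.
  by move=> i; rewrite -[i]inord_val -/(c i) c0.
have modD (C D : elast R) k : modulus (C + D) k = modulus C k + modulus D k.
  by rewrite !modulusE elastDE.
have formE w : F_form (invariant_coeffs c)
    (fun n => ((word_moduli delta w)`_n)%:~R) (fun n => ((word_moduli delta w)`_n)%:~R) = 0.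
  rewrite -[RHS](form0 (std_tensor R w)) /F_form /symblk3 /blk3.
  by rewrite !modulus_word_moduli.
have e1 : c 0%N + c 1%N + c 2%N + c 3%N + c 4%N + c 5%N + c 6%N = 0.
  by move: (formE (0, 0, 0, 0)); word_equation.
have e2 : 2 * c 0%N + c 3%N + c 6%N = 0.
  by move: (formE (1, 1, 2, 2)); word_equation.
have e3 : 2 * c 2%N + c 5%N + 2 * c 6%N = 0.
  by move: (formE (1, 2, 1, 2)); word_equation.
have e4 : c 3%N + 2 * c 6%N = 0.
  by move: (formE (0, 0, 1, 2)); word_equation.
have e5 : c 3%N + c 4%N + c 5%N + 2 * c 6%N = 0.
  by move: (formE (2, 2, 1, 2)); word_equation.
have e6 : c 5%N + 4 * c 6%N = 0.
  by move: (formE (2, 0, 0, 1)); word_equation.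
(* Single words only reach the diagonal coefficients [f11], [f44], [f77], [b11], [b44], [b10_10].
   The sum of two words brings in the cross term [f12], which is the seventh equation. *)
have e7 : c 0%N + c 1%N + c 2%N = 0.
  have := form0 (std_tensor R (0, 0, 0, 0) + std_tensor R (1, 1, 1, 1)).
  rewrite /F_form /symblk3 /blk3 !modD !modulus_word_moduli //.
  by move: e1; word_equation.
by do 7?[case: n => [|n] //]; move=> _; lra.
Qed.

Lemma sum_invariantsE (R : realType) (a : 'I_7 -> R) (C : elast R) :
  (\sum_i a i *: (fun C : elast R => (invariants C)`_i : R^o)) C
    = F_form (invariant_coeffs (fun n => a (inord n))) (modulus C) (modulus C).
Proof.
rewrite invariant_coeffsE fct_sumE; apply: eq_bigr => i _.
by rewrite inord_val.
Qed.

(** The seven [invariants] form a basis: they span because [conditionsP] turns every solution of the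
    conditions into a combination of them. *)
Lemma quadratic_invariants_dim (R : realType) :
  has_dim (quadratic_invariants (@SO3 R)) 7.
Proof.
exists (fun i : 'I_7 => (fun C : elast R => (invariants C)`_i : R^o)).
  exact: invariants_lin_indep.
apply/seteqP; split=> [phi [qphi iphi]|_ [a _ <-]].
  have [_ /conditionsP[a ->] phiE] := invariant_F_form qphi iphi.
  exists (fun i => a i) => //; apply/funext => C.
  rewrite sum_invariantsE phiE !invariant_coeffsE; apply: eq_bigr => i _.
  by rewrite inordK.
split; first exact: F_quadratic (sum_invariantsE a).
exact: F_invariant (sum_invariantsE a).
Qed.

Theorem theorem1 (R : realType) :
  [/\ forall phi : elast R -> R^o, quadratic_form phi ->
        (invariant_under (@SO3 R) phi <->
         exists2 x : coeffs R, forall i, tnth (conditions x) i = 0 &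
           forall C : elast R,
             phi C = ((moduli C)^T *m F_mx x *m moduli C) 0 0),
      lin_indep (fun (i : 'I_12) =>
        ((fun x : coeffs R => tnth (conditions x) i) : coeffs R -> R^o)) &
      has_dim (quadratic_invariants (@SO3 R)) 7].
Proof.
split; [move=> phi qphi | exact: conditions_lin_indep
       | exact: quadratic_invariants_dim].
split=> [/(invariant_F_form qphi)[x condx phiE] | [x /conditionsP[a ->] phiE]].
  by exists x => // C; rewrite moduli_F_mxE.
by apply: (@F_invariant _ a) => C; rewrite phiE moduli_F_mxE.
Qed.
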